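(* Let $N$ be a regular ruled surface in $E^3$ with parametrization $\vec r(s,v)=\vec c(s)+v\vec q(s)$, $\|\vec q(s)\|=1$, where $\vec c$ is the striction curve of $N$ and $s$ is the arc length parameter of $\vec c$, with Frenet frame $\{\vec q,\vec h,\vec a\}$ and non-zero invariants $k_1,k_2$. Then $N$ is a $q$-slant ruled surface if and only if $\det(\vec a',\vec a'',\vec a''')=0$ for all $s$.
   Context: All maps are smooth and defined on an open interval $I\subset\mathbb R$; $E^3$ is Euclidean 3-space. $N$ is given by $\vec r(s,v)=\vec c(s)+v\vec q(s)$, where $\vec c$ is a unit speed curve and $\vec q$ is a unit vector field along $\vec c$ (the ruling). ''Regular'' refers to the base curve $\vec c$ being a regular curve (here unit speed); points where $\vec r$ fails to be an immersion are not excluded. That $\vec c$ is the striction curve means $\langle \vec c\,',\vec q\,'\rangle=0$. Frenet frame of $N$: $\vec a=\dfrac{\vec q\times\vec q\,'}{\|\vec q\,'\|}$ (central tangent), $\vec h=\vec a\times\vec q$ (central normal). The invariants $k_1,k_2$ are the functions in the Frenet formulae $$\vec q\,'=k_1\vec h,\qquad \vec h'=-k_1\vec q+k_2\vec a,\qquad \vec a'=-k_2\vec h,$$ with $'=d/ds$; both are assumed nowhere zero (so $k_1=\|\vec q\,'\|>0$). $N$ is called $q$-slant if there is a fixed unit vector $\vec u$ and a constant angle $\theta\neq\pi/2$ with $\langle\vec q(s),\vec u\rangle=\cos\theta$ for all $s$. *)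

(* Defs.v *)
From mathcomp Require Import all_boot all_order all_algebra.
From mathcomp Require Import all_classical all_reals all_analysis.

Set Implicit Arguments.
Unset Strict Implicit.
Unset Printing Implicit Defensive.

Import Order.TTheory GRing.Theory Num.Theory.
Import numFieldNormedType.Exports.

Local Open Scope ring_scope.
Local Open Scope classical_set_scope.

(* Euclidean 3-space is 'rV[R]_3. The library's norm `|u| on matrices is the
   sup norm; it is used only for the topology (limits and derivatives), and
   lengths are measured with enorm. *)

Definition dotp (R : realType) (u v : 'rV[R]_3) : R := (u *m v^T) 0 0.

Definition enorm (R : realType) (u : 'rV[R]_3) : R := Num.sqrt (dotp u u).

Definition crossp (R : realType) (u v : 'rV[R]_3) : 'rV[R]_3 :=
  \row_(i < 3) [:: u 0 1 * v 0 2 - u 0 2 * v 0 1;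
                   u 0 2 * v 0 0 - u 0 0 * v 0 2;
                   u 0 0 * v 0 1 - u 0 1 * v 0 0]`_i.

Definition det3 (R : realType) (u v w : 'rV[R]_3) : R :=
  \det (\matrix_(i < 3, j < 3) [:: u; v; w]`_i 0 j).

(* Meaningful for open I, where the values of f outside I are irrelevant. *)
Definition smooth_on (R : realType) (I : set R) (f : R -> 'rV[R]_3) : Prop :=
  forall (n : nat) (s : R), I s -> derivable (derive1n n f) s 1.

Section FrenetFrame.
Variables (R : realType) (q : R -> 'rV[R]_3).

Definition central_tangent (s : R) : 'rV[R]_3 :=
  (enorm (derive1 q s))^-1 *: crossp (q s) (derive1 q s).

Definition central_normal (s : R) : 'rV[R]_3 :=
  crossp (central_tangent s) (q s).

Definition frenet_invariants (I : set R) (k1 k2 : R -> R) : Prop :=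
  forall s : R, I s ->
    [/\ derive1 q s = k1 s *: central_normal s,
        derive1 central_normal s = - k1 s *: q s + k2 s *: central_tangent s
      & derive1 central_tangent s = - k2 s *: central_normal s].

(* An angle between two vectors lies in [0, pi]. *)
Definition q_slant (I : set R) : Prop :=
  exists (u : 'rV[R]_3) (theta : R),
    [/\ enorm u = 1, 0 <= theta <= pi, theta <> pi / 2
      & forall s : R, I s -> dotp (q s) u = cos theta].

End FrenetFrame.

(* Main.v *)
(** For every s the frame (q, h, a) is orthonormal, and the vector
    D = q + (k1/k2) a satisfies D' = (k1/k2)' a.  Since a' x a'' = k2^3 D and D
    is orthogonal to a' and a'', differentiating <D, a''> = 0 gives
    det(a', a'', a''') = k2^5 (k1/k2)'.  If the determinant vanishes, then D is
    constant with <q, D> = 1, and D/|D| is a slant axis.  Conversely, if <q, u>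
    is constant, then u is orthogonal to q' = k1 h, hence to a' = - k2 h and to
    all higher derivatives of a, which forces the determinant to vanish. *)

Require Import Defs.
From mathcomp Require Import all_boot all_order all_algebra.
From mathcomp Require Import all_classical all_reals all_analysis.
From mathcomp Require Import ring lra.

Set Implicit Arguments.
Unset Strict Implicit.
Unset Printing Implicit Defensive.

Import Order.TTheory GRing.Theory Num.Theory.
Import numFieldNormedType.Exports.
Local Open Scope ring_scope.
Local Open Scope classical_set_scope.

(** * Dot product, cross product and determinant in coordinates *)

Section VectorAlgebra.
Variable R : realType.
Implicit Types u v w x : 'rV[R]_3.

Lemma forall_ord3 (P : 'I_3 -> Prop) : P 0 -> P 1 -> P 2 -> forall i, P i.
Proof.
move=> P0 P1 P2 -[[|[|[|//]]] i3].
- by rewrite (_ : Ordinal i3 = 0) //; apply/val_inj.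
- by rewrite (_ : Ordinal i3 = 1) //; apply/val_inj.
- by rewrite (_ : Ordinal i3 = 2) //; apply/val_inj.
Qed.

Lemma dotpE u v : dotp u v = u 0 0 * v 0 0 + u 0 1 * v 0 1 + u 0 2 * v 0 2.
Proof.
rewrite /dotp mxE !big_ord_recl big_ord0 !mxE addr0 addrA.
have -> : lift ord0 (lift ord0 (ord0 : 'I_1)) = 2 :> 'I_3 by apply/val_inj.
by have -> : lift ord0 (ord0 : 'I_2) = 1 :> 'I_3 by apply/val_inj.
Qed.

Lemma crosspE u v :
  (crossp u v 0 0 = u 0 1 * v 0 2 - u 0 2 * v 0 1) *
  (crossp u v 0 1 = u 0 2 * v 0 0 - u 0 0 * v 0 2) *
  (crossp u v 0 2 = u 0 0 * v 0 1 - u 0 1 * v 0 0).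
Proof. by rewrite /crossp !mxE. Qed.

Lemma det3E u v w : det3 u v w = dotp (crossp u v) w.
Proof.
rewrite /det3 (expand_det_row _ ord_max) !big_ord_recl big_ord0 /cofactor.
rewrite !(expand_det_row _ ord0) !big_ord_recl !big_ord0 /cofactor !det_mx11.
rewrite !mxE /= !dotpE !crosspE.
(* The row expansions build the same index in several ways; reading entries through functions on
   [nat] lets these indices compute, so that [ring] identifies them. *)
have coord (z : 'rV[R]_3) : exists Z : nat -> R, forall i : 'I_3, z 0 i = Z i.
  by exists (fun k => z 0 (inord k)) => i; rewrite inord_val.
have [[U uE] [V vE] [W wE]] := And3 (coord u) (coord v) (coord w).
by rewrite !uE !vE !wE /= /bump /=; ring.
Qed.

Lemma dotpC u v : dotp u v = dotp v u.
Proof. by rewrite !dotpE; ring. Qed.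

Lemma dotpDl u v w : dotp (u + v) w = dotp u w + dotp v w.
Proof. by rewrite !dotpE !mxE; ring. Qed.

Lemma dotpZl (k : R) u v : dotp (k *: u) v = k * dotp u v.
Proof. by rewrite !dotpE !mxE; ring. Qed.

Lemma dotpDr u v w : dotp w (u + v) = dotp w u + dotp w v.
Proof. by rewrite !dotpE !mxE; ring. Qed.

Lemma dotpZr (k : R) u v : dotp v (k *: u) = k * dotp v u.
Proof. by rewrite !dotpE !mxE; ring. Qed.

Lemma crosspC u v : crossp u v = - crossp v u.
Proof. by apply/rowP; apply: forall_ord3; rewrite [RHS]mxE !crosspE; ring. Qed.

Lemma dotp_crosspl u v : dotp (crossp u v) u = 0.
Proof. by rewrite dotpE !crosspE; ring. Qed.

Lemma dotp_crosspr u v : dotp (crossp u v) v = 0.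
Proof. by rewrite dotpE !crosspE; ring. Qed.

Lemma dotp_crossp u v :
  dotp (crossp u v) (crossp u v) = dotp u u * dotp v v - dotp u v ^+ 2.
Proof. by rewrite !dotpE !crosspE; ring. Qed.

Lemma crosspCA u v w : crossp u (crossp v w) = dotp u w *: v - dotp u v *: w.
Proof.
by apply/rowP; apply: forall_ord3; rewrite !mxE /= ?mxE /= !dotpE; ring.
Qed.

(** The shape of a' x a'' for u, v, w = h, q, a: the component of a'' along h drops out. *)
Lemma crosspDZ (k l m n p : R) u v w :
  crossp (k *: u) (l *: u + m *: (n *: v + p *: w)) =
  (k * m * n) *: crossp u v + (k * m * p) *: crossp u w.
Proof. by apply/rowP; apply: forall_ord3; rewrite !mxE /=; ring. Qed.

(** Follows from det(u, v, w) x = <u, x> v x w + <v, x> w x u + <w, x> u x v. *)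
Lemma det3_eq0 u v w x : x != 0 ->
  dotp u x = 0 -> dotp v x = 0 -> dotp w x = 0 -> det3 u v w = 0.
Proof.
move=> x0 ux vx wx; have : det3 u v w *: x =
    dotp u x *: crossp v w + dotp v x *: crossp w u + dotp w x *: crossp u v.
  by rewrite det3E; apply/rowP; apply: forall_ord3; rewrite !dotpE !mxE /=; ring.
rewrite ux vx wx !scale0r !addr0 => /eqP.
by rewrite scaler_eq0 (negbTE x0) orbF => /eqP.
Qed.

End VectorAlgebra.

(** * Derivatives of vector-valued functions *)

Section Calculus.
Variable R : realType.
Implicit Types (f g : R -> 'rV[R]_3) (I : set R) (s t : R).

Lemma is_derive_mxP m n (f : R -> 'M[R]_(m, n)) (df : 'M[R]_(m, n)) s :
  is_derive s (1 : R) f df <->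
  forall i j, is_derive s (1 : R) (fun t => f t i j) (df i j).
Proof.
split=> [[fs <-] i j|fs].
  by rewrite derive_mx // mxE; apply: derivableP; exact: (derivable_mxP _ _ _).1.
have fs' : derivable f s 1 by apply/derivable_mxP => i j; exact: ex_derive.
apply: DeriveDef => //; rewrite derive_mx //.
by apply/matrixP => i j; rewrite mxE derive_val.
Qed.

Lemma is_derive_dotp f g df dg s :
  is_derive s (1 : R) f df -> is_derive s (1 : R) g dg ->
  is_derive s (1 : R) (fun t => dotp (f t) (g t)) (dotp df (g s) + dotp (f s) dg).
Proof.
move=> /is_derive_mxP fs /is_derive_mxP gs.
under eq_fun do rewrite dotpE.
pose F i t := f t 0 i * g t 0 i.
have dF i : is_derive s (1 : R) (F i) (f s 0 i * dg 0 i + g s 0 i * df 0 i).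
  exact: is_deriveM.
have := is_deriveD (is_deriveD (dF 0) (dF 1)) (dF 2).
by move/is_derive_eq; apply; rewrite !dotpE; ring.
Qed.

Lemma is_derive_scale (k : R -> R) f dk df s :
  is_derive s (1 : R) k dk -> is_derive s (1 : R) f df ->
  is_derive s (1 : R) (fun t => k t *: f t) (dk *: f s + k s *: df).
Proof.
move=> ks /is_derive_mxP fs; apply/is_derive_mxP => i j.
under eq_fun do rewrite mxE.
have := is_deriveM ks (fs i j); move/is_derive_eq; apply.
by rewrite !mxE /= /GRing.scale /=; ring.
Qed.

(* On a divergent difference quotient [derive1] takes the junk value 0. *)
Lemma derivable_neq0 m n (f : R -> 'M[R]_(m, n)) s :
  derive1 f s != 0 -> derivable f s 1.
Proof.
move/eqP => f0; apply: contrapT => /dvgP dv; apply: f0; rewrite derive1E /derive dv.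
by apply/matrixP => i j; rewrite !mxE.
Qed.

Lemma is_derive0_cst I (f : R -> R) : is_interval I ->
  (forall s, I s -> is_derive s (1 : R) f 0) ->
  forall s t, I s -> I t -> f s = f t.
Proof.
move=> Iitv f0 s t Is It; wlog st : s t Is It / s <= t.
  by move=> H; have [/H|/ltW/H] := leP s t; [exact|move=> <-].
have stI x : x \in `[s, t]%R -> I x.
  by rewrite in_itv => /andP[? ?]; apply: (Iitv s t) => //; apply/andP.
have [||x _] := @MVT_segment R f (cst 0) s t st.
- by move=> x /subset_itv_oo_cc /stI; exact: f0.
- apply: derivable_within_continuous => x /stI /f0 H; exact: ex_derive.
- by rewrite mul0r => /eqP; rewrite subr_eq0 => /eqP.
Qed.

End Calculus.

(** * Differentiability of finite order on an open set *)

Section NDerivable.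
Variables (R : realType) (I : set R).
Hypothesis I_open : open I.

(** The order is kept finite because the regularity of the frame is gained one order at a time; [V]
    covers scalar and vector functions alike. *)
Fixpoint n_derivable (V : normedModType R) (n : nat) (f : R -> V) : Prop :=
  if n is m.+1 then
    (forall s : R, I s -> derivable f s 1) /\ @n_derivable V m (derive1 f)
  else True.

Lemma near_open (V : Type) (f g : R -> V) s :
  (forall t, I t -> f t = g t) -> I s -> \forall t \near s, f t = g t.
Proof.
move=> fg Is; have : nbhs s I by exact: open_nbhs_nbhs.
by apply: filterS => t /fg.
Qed.

Lemma is_derive_on (V : normedModType R) (f g : R -> V) (df : V) (s : R) :
  (forall t, I t -> f t = g t) -> I s ->
  is_derive s (1 : R) f df -> is_derive s (1 : R) g df.
Proof. by move=> fg Is; apply: near_eq_is_derive; exact: near_open. Qed.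

Lemma n_derivable_on (V : normedModType R) n (f g : R -> V) :
  (forall t, I t -> f t = g t) -> n_derivable n f -> n_derivable n g.
Proof.
elim: n f g => [//|n IHn] f g fg [fd /IHn f'n]; split=> [s Is|].
  by apply: near_eq_derivable (fd s Is); exact: near_open.
by apply: f'n => t It; rewrite !derive1E; apply: near_eq_derive; exact: near_open.
Qed.

Lemma n_derivableW (V : normedModType R) n (f : R -> V) :
  n_derivable n.+1 f -> n_derivable n f.
Proof. by elim: n f => [//|n IHn] f [fd /IHn]; split. Qed.

(** The induction step of all closure lemmas below: [df] has to be the derivative only on [I]. *)
Lemma n_derivableS (V : normedModType R) n (f df : R -> V) :
  (forall s, I s -> is_derive s (1 : R) f (df s)) -> n_derivable n df ->
  n_derivable n.+1 f.
Proof.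
move=> fd dfn; split=> [s /fd ?|]; first exact: ex_derive.
by apply: n_derivable_on dfn => t /fd ?; rewrite derive1E derive_val.
Qed.

Lemma n_derivable_is_derive (V : normedModType R) n (f : R -> V) s :
  n_derivable n.+1 f -> I s -> is_derive s (1 : R) f (derive1 f s).
Proof. by move=> [fd _] Is; rewrite derive1E; exact/derivableP/fd. Qed.

Lemma n_derivableD (V : normedModType R) n (f g : R -> V) :
  n_derivable n f -> n_derivable n g -> n_derivable n (fun t => f t + g t).
Proof.
elim: n f g => [//|n IHn] f g fn gn.
apply: (@n_derivableS _ _ _ (fun t => derive1 f t + derive1 g t)) => [s Is|].
  by apply: is_deriveD; apply: n_derivable_is_derive Is; eassumption.
by apply: IHn; [case: fn|case: gn].
Qed.

Lemma n_derivableN (V : normedModType R) n (f : R -> V) :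
  n_derivable n f -> n_derivable n (fun t => - f t).
Proof.
elim: n f => [//|n IHn] f fn.
apply: (@n_derivableS _ _ _ (fun t => - derive1 f t)) => [s Is|].
  by apply: is_deriveN; apply: n_derivable_is_derive Is; eassumption.
by apply: IHn; case: fn.
Qed.

Lemma n_derivableM n (f g : R -> R) :
  n_derivable n f -> n_derivable n g -> n_derivable n (fun t => f t * g t).
Proof.
elim: n f g => [//|n IHn] f g fn gn.
apply: (@n_derivableS _ _ _ (fun t => f t * derive1 g t + g t * derive1 f t)).
  by move=> s Is; apply: is_deriveM; apply: n_derivable_is_derive Is; eassumption.
by apply: n_derivableD; apply: IHn;
  [exact: n_derivableW|case: gn|exact: n_derivableW|case: fn].
Qed.

Lemma is_deriveV (f : R -> R) (df s : R) : f s != 0 ->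
  is_derive s (1 : R) f df ->
  is_derive s (1 : R) (fun t => (f t)^-1) (- (f s) ^- 2 * df).
Proof.
by move=> fs [fd <-]; apply: DeriveDef; [exact: derivableV|rewrite deriveV].
Qed.

Lemma n_derivableV n (f : R -> R) : (forall s, I s -> f s != 0) ->
  n_derivable n f -> n_derivable n (fun t => (f t)^-1).
Proof.
move=> f0; elim: n => [//|n IHn] fn.
have fVn := IHn (n_derivableW fn).
(* The square is written as a product of inverses, so that the product rule and the induction
   hypothesis apply. *)
apply: (@n_derivableS _ _ _ (fun t => - ((f t)^-1 * (f t)^-1) * derive1 f t)).
  move=> s Is; rewrite -invfM -expr2; apply: is_deriveV; first exact: f0.
  exact: n_derivable_is_derive fn Is.
by case: fn => _ f'n; do 2?[apply: n_derivableM => //; apply: n_derivableN].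
Qed.

(** Brings dot, scalar and cross products down to scalar products of coordinates. *)
Lemma n_derivable_mx m p n (f : R -> 'M[R]_(m, p)) :
  n_derivable n f <-> forall i j, n_derivable n (fun t => f t i j).
Proof.
elim: n f => [//|n IHn] f; split=> [fn i j|fn].
  apply: (@n_derivableS _ _ _ (fun t => derive1 f t i j)); last first.
    by case: fn => _ /IHn.
  move=> s Is; apply: (is_derive_mxP _ _ _).1.
  exact: n_derivable_is_derive fn Is.
apply: (@n_derivableS _ _ _ (fun t => \matrix_(i, j) derive1 (fun t => f t i j) t)).
  move=> s Is; apply/is_derive_mxP => i j; rewrite mxE.
  exact: n_derivable_is_derive (fn i j) Is.
apply/IHn => i j; under eq_fun do rewrite mxE.
by case: (fn i j).
Qed.

Lemma n_derivable_dotp n (f g : R -> 'rV[R]_3) :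
  n_derivable n f -> n_derivable n g -> n_derivable n (fun t => dotp (f t) (g t)).
Proof.
move=> /n_derivable_mx fn /n_derivable_mx gn; under eq_fun do rewrite dotpE.
by do 2?apply: n_derivableD; exact: n_derivableM.
Qed.

Lemma n_derivable_scale n (k : R -> R) (f : R -> 'rV[R]_3) :
  n_derivable n k -> n_derivable n f -> n_derivable n (fun t => k t *: f t).
Proof.
move=> kn /n_derivable_mx fn; apply/n_derivable_mx => i j.
by under eq_fun do rewrite mxE; exact: n_derivableM.
Qed.

Lemma n_derivable_crossp n (f g : R -> 'rV[R]_3) :
  n_derivable n f -> n_derivable n g -> n_derivable n (fun t => crossp (f t) (g t)).
Proof.
move=> /n_derivable_mx fn /n_derivable_mx gn; apply/n_derivable_mx => i.
rewrite (ord1 i); apply: forall_ord3; under eq_fun do rewrite crosspE.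
all: by apply: n_derivableD; [|apply: n_derivableN]; exact: n_derivableM.
Qed.

Lemma smooth_n_derivable n (f : R -> 'rV[R]_3) :
  smooth_on I f -> n_derivable n f.
Proof.
elim: n f => [//|n IHn] f fs; split; first exact: (fs 0%N).
(* [derive1n] adds derivatives on the outside, whereas [n_derivable] peels off the innermost one. *)
by apply: IHn => k s Is; rewrite -derive1Sn; exact: fs.
Qed.

End NDerivable.

(** The product rule for a scalar product that is constant on [I]; most scalar products of the frame
    with its derivatives are found this way. *)
Lemma dotp_cst_derive (R : realType) (I : set R) (f g : R -> 'rV[R]_3)
    (df dg : 'rV[R]_3) (c s : R) :
  open I -> (forall t, I t -> dotp (f t) (g t) = c) -> I s ->
  is_derive s (1 : R) f df -> is_derive s (1 : R) g dg ->
  dotp df (g s) + dotp (f s) dg = 0.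
Proof.
move=> I_open fgc Is fd gd; have fgd := is_derive_dotp fd gd.
have [_ <-] := is_derive_on I_open fgc Is fgd.
exact: derive_cst.
Qed.

(** * Orthonormality and regularity of the Frenet frame *)

Section Frame.
Variables (R : realType) (I : set R) (q : R -> 'rV[R]_3) (k1 k2 : R -> R).
Hypotheses (I_open : open I) (q_smooth : smooth_on I q).
Hypothesis q_unit : forall s : R, I s -> enorm (q s) = 1.
Hypothesis k_inv : frenet_invariants q I k1 k2.
Hypothesis k1_neq0 : forall s : R, I s -> k1 s <> 0.
Hypothesis k2_neq0 : forall s : R, I s -> k2 s <> 0.

Local Notation h := (central_normal q).
Local Notation a := (central_tangent q).

Lemma dotp_qq s : I s -> dotp (q s) (q s) = 1.
Proof.
move=> /q_unit q1; have qq0 : 0 <= dotp (q s) (q s) by rewrite dotpE; nra.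
by rewrite -(sqr_sqrtr qq0) -/(enorm _) q1 expr1n.
Qed.

Lemma dotp_aq s : dotp (a s) (q s) = 0.
Proof. by rewrite dotpZl dotp_crosspl mulr0. Qed.

Lemma dotp_hq s : dotp (h s) (q s) = 0.
Proof. exact: dotp_crosspr. Qed.

Lemma dotp_ha s : dotp (h s) (a s) = 0.
Proof. exact: dotp_crosspl. Qed.

Lemma dotp_dhq s : I s -> dotp (derive1 h s) (q s) = - k1 s.
Proof.
move=> Is; have [_ -> _] := k_inv Is.
by rewrite dotpDl 2!dotpZl dotp_aq dotp_qq // mulr0 mulr1 addr0.
Qed.

Lemma is_derive_q s : I s -> is_derive s (1 : R) q (k1 s *: h s).
Proof.
move=> Is; have [<- _ _] := k_inv Is; rewrite derive1E.
by apply: derivableP; exact: (q_smooth (n := 0%N)) Is.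
Qed.

(** The Frenet formula gives <h', q> = - k1, which is nonzero, so [derive1 h s] cannot be the junk
    value 0. *)
Lemma derivable_h s : I s -> derivable h s (1 : R).
Proof.
move=> Is; apply: derivable_neq0; apply/eqP => h0; apply: (k1_neq0 Is).
by apply/eqP; rewrite -oppr_eq0 -dotp_dhq // h0 dotpE !mxE !mul0r !addr0.
Qed.

Lemma is_derive_h s :
  I s -> is_derive s (1 : R) h (- k1 s *: q s + k2 s *: a s).
Proof.
move=> Is; have [_ <- _] := k_inv Is; rewrite derive1E.
exact/derivableP/derivable_h.
Qed.

(* If q' vanished at s, the junk value of the frame there would be a = h = 0;
   differentiating <h, q> = 0 excludes this. *)
Lemma dotp_hh s : I s -> dotp (h s) (h s) = 1.
Proof.
move=> Is.
have := dotp_cst_derive I_open (fun t _ => dotp_hq t) Is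
  (is_derive_h Is) (is_derive_q Is).
rewrite dotpDl 2!dotpZl dotpZr dotp_aq dotp_qq // mulr0 mulr1 addr0 addrC.
move/eqP; rewrite subr_eq0 -[eqbRHS]mulr1 => /eqP /mulfI; apply.
exact/eqP/k1_neq0.
Qed.

(** Since h = a x q with q a unit vector orthogonal to a, Lagrange's identity gives |h| = |a|. *)
Lemma dotp_aa s : I s -> dotp (a s) (a s) = 1.
Proof.
move=> Is; rewrite -(dotp_hh Is) dotp_crossp dotp_aq dotp_qq //.
by rewrite mulr1 expr0n subr0.
Qed.

Lemma crossp_qh s : I s -> crossp (q s) (h s) = a s.
Proof.
by move=> Is; rewrite crosspCA dotp_qq // dotpC dotp_aq scale1r scale0r subr0.
Qed.

Lemma crossp_hq s : I s -> crossp (h s) (q s) = - a s.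
Proof. by move=> Is; rewrite crosspC crossp_qh. Qed.

Lemma crossp_ha s : I s -> crossp (h s) (a s) = q s.
Proof.
move=> Is; rewrite crosspC crosspCA dotp_aq dotp_aa //.
by rewrite scale0r sub0r opprK scale1r.
Qed.

(** Scalar products such as this one and [k2E] transfer differentiability from the frame to the
    invariants. *)
Lemma k1E s : I s -> dotp (derive1 q s) (h s) = k1 s.
Proof.
by move=> Is; have [-> _ _] := k_inv Is; rewrite dotpZl dotp_hh // mulr1.
Qed.

Lemma k2E s : I s -> dotp (derive1 h s) (a s) = k2 s.
Proof.
move=> Is; have [_ -> _] := k_inv Is.
by rewrite dotpDl 2!dotpZl dotpC dotp_aq dotp_aa // mulr0 add0r mulr1.
Qed.

(* Since h' is orthogonal to q', k1' = <q'', h>: hence k1, and with it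
   h = q' / k1, gains one order of differentiability over h. *)
Lemma n_derivable_k1_h n : n_derivable I n k1 /\ n_derivable I n h.
Proof.
have q'n m : n_derivable I m (derive1 q).
  by have [] := smooth_n_derivable m.+1 q_smooth.
have q''n m : n_derivable I m (derive1 (derive1 q)) by have [] := q'n m.+1.
elim: n => [//|n [_ IHn]].
have k1n : n_derivable I n.+1 k1.
  apply: (@n_derivableS _ _ I_open _ _ _
      (fun s => dotp (derive1 (derive1 q) s) (h s))).
    move=> s Is; apply: (is_derive_on I_open k1E Is).
    have := is_derive_dotp
      (n_derivable_is_derive (q'n 1%N) Is) (is_derive_h Is).
    move/is_derive_eq; apply; have [-> _ _] := k_inv Is.
    by rewrite dotpZl dotpDr 2!dotpZr dotp_hq dotp_ha !mulr0 addr0 mulr0 addr0.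
  exact: n_derivable_dotp.
split=> //.
apply: (@n_derivable_on _ _ I_open _ _ (fun t => (k1 t)^-1 *: derive1 q t)).
  move=> t It; have [-> _ _] := k_inv It.
  by rewrite scalerA mulVf ?scale1r //; exact/eqP/k1_neq0.
apply: n_derivable_scale => //; apply: n_derivableV => // t It.
exact/eqP/k1_neq0.
Qed.

(** Through a = q x h, which avoids differentiating the norm of q'. *)
Lemma n_derivable_a n : n_derivable I n a.
Proof.
apply: (n_derivable_on I_open crossp_qh).
apply: n_derivable_crossp => //; first exact: smooth_n_derivable.
by case: (n_derivable_k1_h n).
Qed.

Lemma n_derivable_k2 n : n_derivable I n k2.
Proof.
apply: (n_derivable_on I_open k2E).
apply: n_derivable_dotp => //; last exact: n_derivable_a.
(* As k2 = <h', a>, [h] is needed at order n + 1. *)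
by case: (n_derivable_k1_h n.+1) => _ [].
Qed.

Lemma is_derive_a n s : I s ->
  is_derive s (1 : R) (derive1n n a) (derive1n n.+1 a s).
Proof.
have an : n_derivable I 1 (derive1n n a).
  suff: forall m, n_derivable I m (derive1n n a) by apply.
  by elim: n => [|n IHn] m; [exact: n_derivable_a|case: (IHn m.+1)].
by move=> Is; exact: (n_derivable_is_derive an Is).
Qed.

Lemma derive1_a s : I s -> derive1n 1 a s = - k2 s *: h s.
Proof. by case/k_inv. Qed.

(** * The Darboux vector and the determinant *)

(** The reciprocal of the geodesic curvature of the spherical curve [q]. *)
Definition curvature_ratio s : R := k1 s / k2 s.

(* The Darboux vector k2 q + k1 a divided by k2. *)
Definition darboux s : 'rV[R]_3 := q s + curvature_ratio s *: a s.

(** The terms along h cancel: q' = k1 h and (k1/k2) a' = - k1 h. *)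
Lemma is_derive_darboux s : I s ->
  is_derive s (1 : R) darboux (derive1 curvature_ratio s *: a s).
Proof.
move=> Is; have rn : n_derivable I 1 curvature_ratio.
  apply: n_derivableM => //; first by case: (n_derivable_k1_h 1).
  apply: n_derivableV => //; last exact: n_derivable_k2.
  by move=> t /k2_neq0 /eqP.
have := is_deriveD (is_derive_q Is)
  (is_derive_scale (n_derivable_is_derive rn Is) (is_derive_a 0 Is)).
move/is_derive_eq; apply; rewrite derive1_a // [curvature_ratio s *: _]scalerA.
rewrite addrC -addrA -scalerDl.
rewrite (_ : _ + k1 s = 0) ?scale0r ?addr0 // /curvature_ratio.
by rewrite mulrN divfK ?addNr //; exact/eqP/k2_neq0.
Qed.

(** Here a' = - k2 h and a'' = - k2' h + k1 k2 q - k2^2 a; with h x q = - a and h x a = q the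
    product is k2^2 (k2 q + k1 a). *)
Lemma crossp_a1_a2 s : I s ->
  crossp (derive1n 1 a s) (derive1n 2 a s) = k2 s ^+ 3 *: darboux s.
Proof.
move=> Is; have k2' := n_derivable_is_derive (n_derivable_k2 1) Is.
have a2 := is_derive_scale (is_deriveN k2') (is_derive_h Is).
have a1 t : I t -> - k2 t *: h t = derive1n 1 a t by move=> It; rewrite derive1_a.
have [_] := is_derive_on I_open a1 Is a2.
rewrite -derive1E -derive1nS => ->; rewrite -a1 // crosspDZ.
rewrite (_ : (- k2) s = - k2 s) // crossp_hq // crossp_ha //.
rewrite /darboux /curvature_ratio scalerDr scalerA scalerN -scaleNr addrC.
congr (_ *: _ + _ *: _); first by ring.
by field; exact/eqP/k2_neq0.
Qed.

(** By the previous lemma the determinant is k2^3 <D, a'''>. Differentiating <D, a''> = 0 gives <D,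
    a'''> = - (k1/k2)' <a, a''>, so a''' is never expanded. *)
Lemma det3_a s : I s ->
  det3 (derive1n 1 a s) (derive1n 2 a s) (derive1n 3 a s) =
  k2 s ^+ 5 * derive1 curvature_ratio s.
Proof.
move=> Is.
have a_a1 t : I t -> dotp (a t) (derive1n 1 a t) = 0.
  by move=> It; rewrite derive1_a // dotpZr dotpC dotp_ha mulr0.
(* Differentiating <a, a'> = 0 gives <a, a''> = - |a'|^2. *)
have a_a2 t : I t -> dotp (a t) (derive1n 2 a t) = - k2 t ^+ 2.
  move=> It; have := dotp_cst_derive I_open a_a1 It
    (is_derive_a 0 It) (is_derive_a 1 It).
  rewrite derive1_a // dotpZl dotpZr dotp_hh // => /eqP.
  by rewrite addrC addr_eq0 => /eqP ->; ring.
have d_a1 t : I t -> dotp (darboux t) (derive1n 1 a t) = 0.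
  move=> It; rewrite dotpDl dotpZl a_a1 // mulr0 addr0 derive1_a //.
  by rewrite dotpZr dotpC dotp_hq mulr0.
have d_a2 t : I t -> dotp (darboux t) (derive1n 2 a t) = 0.
  move=> It; have := dotp_cst_derive I_open d_a1 It
    (is_derive_darboux It) (is_derive_a 1 It).
  by rewrite dotpZl a_a1 // mulr0 add0r.
have := dotp_cst_derive I_open d_a2 Is
  (is_derive_darboux Is) (is_derive_a 2 Is).
rewrite dotpZl a_a2 // => /eqP; rewrite addrC addr_eq0 => /eqP d_a3.
by rewrite det3E crossp_a1_a2 // dotpZl d_a3; ring.
Qed.

(** * The two implications *)

Lemma slant_det3 : q_slant q I -> forall s, I s ->
  det3 (derive1n 1 a s) (derive1n 2 a s) (derive1n 3 a s) = 0.
Proof.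
move=> [u [theta [u1 _ _ qu]]] s Is.
have u_neq0 : u != 0.
  apply: contra_eq_neq u1 => ->; rewrite /enorm dotpE !mxE !mul0r !addr0 sqrtr0.
  by rewrite eq_sym oner_neq0.
(* Used in turn for q, a' and a''; the step from q' to a' goes through their common direction h. *)
have cst_perp (f df : R -> 'rV[R]_3) c t :
    I t -> (forall x, I x -> dotp (f x) u = c) ->
    is_derive t (1 : R) f (df t) -> dotp (df t) u = 0.
  move=> It fu fd.
  have := dotp_cst_derive I_open fu It fd (is_derive_cst u t (1 : R)).
  rewrite [X in _ + X](_ : _ = 0) ?addr0 //.
  by rewrite dotpE !mxE !mulr0 !addr0.
have hu t : I t -> dotp (h t) u = 0.
  move=> It.
  have /eqP := cst_perp q (fun s => k1 s *: h s) _ t It qu (is_derive_q It).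
  by rewrite dotpZl mulf_eq0 => /orP[/eqP /(k1_neq0 It) //|/eqP].
have a1u t : I t -> dotp (derive1n 1 a t) u = 0.
  by move=> It; rewrite derive1_a // dotpZl hu // mulr0.
have a2u t : I t -> dotp (derive1n 2 a t) u = 0.
  by move=> It; apply: (cst_perp _ (derive1n 2 a) _ _ It a1u); exact: is_derive_a.
have a3u t : I t -> dotp (derive1n 3 a t) u = 0.
  by move=> It; apply: (cst_perp _ (derive1n 3 a) _ _ It a2u); exact: is_derive_a.
exact: det3_eq0 u_neq0 (a1u _ Is) (a2u _ Is) (a3u _ Is).
Qed.

Lemma det3_slant : is_interval I ->
  (forall s, I s -> det3 (derive1n 1 a s) (derive1n 2 a s) (derive1n 3 a s) = 0) ->
  q_slant q I.
Proof.
move=> I_interval det0; have [[s0 Is0]|I0] := pselect (exists s, I s); last first.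
  (* On an empty [I] any unit vector and any admissible angle will do. *)
  exists (delta_mx 0 0), 0; split.
  - by rewrite /enorm dotpE !mxE /= mulr1 !mulr0 !addr0 sqrtr1.
  - by rewrite lexx pi_ge0.
  - by apply/eqP; rewrite eq_sym mulf_neq0 ?invr_eq0 ?pnatr_eq0 // gt_eqF ?pi_gt0.
  - by move=> s Is; case: I0; exists s.
have r'0 s : I s -> derive1 curvature_ratio s = 0.
  move=> Is; have /eqP := det0 _ Is; rewrite det3_a // mulf_eq0 expf_eq0 /=.
  by move=> /orP[/eqP /(k2_neq0 Is) //|/eqP].
have dE s : I s -> darboux s = darboux s0.
  move=> Is; apply/rowP => i.
  apply: (@is_derive0_cst _ _ (fun t => darboux t 0 i) I_interval) => // t It.
  have := is_derive_darboux It; rewrite r'0 // scale0r => /is_derive_mxP /(_ 0 i).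
  by rewrite mxE.
set d := darboux s0 in dE.
(* |D|^2 = 1 + (k1/k2)^2, so D is nonzero and 1/|D| lies in the domain of [acos]. *)
have dd : 1 <= dotp d d.
  rewrite /d dotpDl !dotpDr 2!dotpZl 2!dotpZr dotp_aa // dotp_qq // dotpC dotp_aq.
  nra.
have ed : 1 <= enorm d by rewrite /enorm -sqrtr1 ler_wsqrtr.
have ed0 : 0 < enorm d by exact: lt_le_trans ed.
have edV : -1 <= (enorm d)^-1 <= 1.
  by rewrite invf_le1 // ed andbT (le_trans (lerN10 _)) // invr_ge0 ltW.
(* As <q, D> = 1, the unit vector D/|D| makes with q an angle of cosine 1/|D|, which is nonzero and
   so excludes pi/2. *)
exists ((enorm d)^-1 *: d), (acos (enorm d)^-1); split.
- rewrite {1}/enorm dotpZl dotpZr mulrA -expr2 sqrtrM ?sqr_ge0 // sqrtr_sqr.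
  by rewrite ger0_norm ?invr_ge0 ?(ltW ed0) // mulVf ?gt_eqF.
- by rewrite acos_ge0 // acos_lepi.
- move/(congr1 cos); rewrite acosK ?in_itv //= cos_pihalf => /eqP.
  by rewrite invr_eq0 gt_eqF.
- move=> s Is; rewrite acosK ?in_itv //= -(dE _ Is) dotpZr dotpDr dotpZr.
  by rewrite dotp_qq // dotpC dotp_aq mulr0 addr0 mulr1.
Qed.

End Frame.

Theorem theorem3p3 (R : realType) (I : set R)
    (I_open : open I) (I_interval : is_interval I)
    (c q : R -> 'rV[R]_3) (r : R -> R -> 'rV[R]_3)
    (r_def : forall s v : R, I s -> r s v = c s + v *: q s)
    (c_smooth : smooth_on I c) (q_smooth : smooth_on I q)
    (c_unit_speed : forall s : R, I s -> enorm (derive1 c s) = 1)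
    (q_unit : forall s : R, I s -> enorm (q s) = 1)
    (c_striction : forall s : R, I s -> dotp (derive1 c s) (derive1 q s) = 0)
    (k1 k2 : R -> R) (k_inv : frenet_invariants q I k1 k2)
    (k1_neq0 : forall s : R, I s -> k1 s <> 0)
    (k2_neq0 : forall s : R, I s -> k2 s <> 0) :
  q_slant q I <->
  (forall s : R, I s ->
     det3 (derive1n 1 (central_tangent q) s) (derive1n 2 (central_tangent q) s)
       (derive1n 3 (central_tangent q) s) = 0).
Proof.
split; first exact: (slant_det3 I_open q_smooth q_unit k_inv).
exact: (det3_slant I_open q_smooth q_unit k_inv).
Qed.
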